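(* (Coherence of $\mathcal C_\Gamma$.) Let $\mathcal C_\Gamma$ be the category determined by a set of objects (words) and a set $\Gamma$ of basic arrow terms as in the context. For $u$ and $v$ arrow terms of $\mathcal C_\Gamma$ of the same type (i.e. with the same source and the same target) we have $u=v$ in $\mathcal C_\Gamma$ if and only if $u$ and $v$ have the same graph.
   Context: Fix an alphabet, whose members are called atoms. $A,B,P,Q,R,S,U,\dots$ denote finite (possibly empty) words of atoms, $p,q,r,s,\dots$ denote atoms, $e$ is the empty word, $|A|$ is the length of $A$, and juxtaposition is concatenation. Fix a set of words (not necessarily all), called objects. $\Gamma$ is a set of formal basic arrow terms such that: - for every object $A$ the arrow term $A:A\to A$ (standing for the identity $\mathbf 1_A$) is in $\Gamma$; - all other members of $\Gamma$ are of the form $A[p,q]B:ApqB\to AqpB$, where $ApqB$ and $AqpB$ are objects; - $\Gamma$ satisfies condition ($\Gamma$): for each instance of the equations (C1) and (C2) below, if all the basic arrow terms on one side are in $\Gamma$, then all the basic arrow terms on the other side are in $\Gamma$. Arrow terms of $\mathcal C_\Gamma$ are generated from $\Gamma$ by composition: for $u:A\to B$ and $v:B\to C$, $v\circ u:A\to C$. The arrows of $\mathcal C_\Gamma$ are equivalence classes of arrow terms under the smallest equivalence relation $=$ between arrow terms of the same type that is a congruence for $\circ$, satisfies the category axioms ($u\circ A=u=B\circ u$ for $u:A\to B$; associativity of $\circ$), and contains all instances, with both sides arrow terms, of: - (C1) $AsrU[p,q]B\circ A[r,s]UpqB=A[r,s]UqpB\circ ArsU[p,q]B$; - (C2) $As[p,r]B\circ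 A[p,s]rB\circ Ap[r,s]B=A[r,s]pB\circ Ar[p,s]B\circ A[p,r]sB$; - (C3) $A[p,r]B\circ A[r,p]B=ArpB$. (Here, e.g., $A[r,s]UpqB$ is the basic arrow term $A[r,s]B'$ with $B'=UpqB$, and $ArpB$ is the identity on the object $ArpB$.) Graph: the graph of an arrow term $u:A\to B$ is a bijection from the positions (occurrences of atoms) in the word $A$ to the positions in the word $B$, defined by: the graph of the identity $A:A\to A$ is the identity; the graph of $A[p,q]B$ exchanges the positions $|A|+1$ and $|A|+2$ (so the displayed occurrence of $p$ in the source goes to that of $p$ in the target, likewise for $q$) and fixes all other positions; the graph of $v\circ u$ is the composite of the bijections of $u$ and $v$. *)

(* Defs.v *)
From mathcomp Require Import all_boot zify.

Set Implicit Arguments.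
Unset Strict Implicit.
Unset Printing Implicit Defensive.

Declare Scope arrow_scope.
Delimit Scope arrow_scope with arr.

(* [Id A] is the formal term A : A -> A standing for the identity, and
   [Swap A p q B] is the formal term A[p,q]B : ApqB -> AqpB. *)
Inductive basic (T : Type) : Type :=
| Id of seq T
| Swap of seq T & T & T & seq T.

Definition src (T : Type) (b : basic T) : seq T :=
  match b with
  | Id A => A
  | Swap A p q B => A ++ [:: p; q] ++ B
  end.

Definition tgt (T : Type) (b : basic T) : seq T :=
  match b with
  | Id A => A
  | Swap A p q B => A ++ [:: q; p] ++ B
  end.

(* Untyped compositions of basic terms: well-typedness is the separate
   predicate [arrow], since the two sides of (C1) and (C2) have sources and
   targets that agree only up to associativity of concatenation. *)
Inductive term (T : Type) : Type :=
| Basic of basic T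
| Comp of term T & term T.

Coercion Basic : basic >-> term.
Bind Scope arrow_scope with term.
Notation "v ∘ u" := (Comp v u)
  (at level 40, left associativity) : arrow_scope.

Fixpoint basics_in (T : Type) (Gamma : basic T -> Prop) (u : term T) : Prop :=
  match u with
  | Basic b => Gamma b
  | Comp v u => basics_in Gamma v /\ basics_in Gamma u
  end.

Inductive eqC12 (T : Type) : term T -> term T -> Prop :=
| EqC1 A r s U p q B :
    eqC12 (Swap (A ++ [:: s; r] ++ U) p q B ∘ Swap A r s (U ++ [:: p; q] ++ B))
          (Swap A r s (U ++ [:: q; p] ++ B) ∘ Swap (A ++ [:: r; s] ++ U) p q B)
| EqC2 A p r s B :
    eqC12 (Swap (A ++ [:: s]) p r B ∘ Swap A p s ([:: r] ++ B)
             ∘ Swap (A ++ [:: p]) r s B)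
          (Swap A r s ([:: p] ++ B) ∘ Swap (A ++ [:: r]) p s B
             ∘ Swap A p r ([:: s] ++ B)).

Inductive eqC3 (T : Type) : term T -> term T -> Prop :=
| EqC3 A p r B :
    eqC3 (Swap A p r B ∘ Swap A r p B) (Id (A ++ [:: r; p] ++ B)).

Record basic_arrow_set (T : Type) (obj : seq T -> Prop)
    (Gamma : basic T -> Prop) : Prop := BasicArrowSet {
  Gamma_id : forall A, Gamma (Id A) <-> obj A;
  Gamma_swap : forall A p q B, Gamma (Swap A p q B) ->
    obj (A ++ [:: p; q] ++ B) /\ obj (A ++ [:: q; p] ++ B);
  Gamma_C12 : forall u v, eqC12 u v ->
    (basics_in Gamma u <-> basics_in Gamma v)
}.

(* [arrow Gamma A B u]: u is an arrow term of type A -> B. *)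
Inductive arrow (T : Type) (Gamma : basic T -> Prop) :
    seq T -> seq T -> term T -> Prop :=
| arrow_basic b : Gamma b -> arrow Gamma (src b) (tgt b) b
| arrow_comp A B C u v :
    arrow Gamma A B u -> arrow Gamma B C v -> arrow Gamma A C (v ∘ u).

(* [arrow_eq Gamma A B u v]: u = v as arrows A -> B of C_Gamma. *)
Inductive arrow_eq (T : Type) (Gamma : basic T -> Prop) :
    seq T -> seq T -> term T -> term T -> Prop :=
| arrow_eq_refl A B u : arrow Gamma A B u -> arrow_eq Gamma A B u u
| arrow_eq_sym A B u v : arrow_eq Gamma A B u v -> arrow_eq Gamma A B v u
| arrow_eq_trans A B u v w :
    arrow_eq Gamma A B u v -> arrow_eq Gamma A B v w -> arrow_eq Gamma A B u w
| arrow_eq_comp A B C u u' v v' :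
    arrow_eq Gamma A B u u' -> arrow_eq Gamma B C v v' ->
    arrow_eq Gamma A C (v ∘ u) (v' ∘ u')
| arrow_eq_idr A B u : arrow Gamma A B u -> arrow_eq Gamma A B (u ∘ Id A) u
| arrow_eq_idl A B u : arrow Gamma A B u -> arrow_eq Gamma A B (Id B ∘ u) u
| arrow_eq_assoc A B C D u v w :
    arrow Gamma A B u -> arrow Gamma B C v -> arrow Gamma C D w ->
    arrow_eq Gamma A D ((w ∘ v) ∘ u) (w ∘ (v ∘ u))
| arrow_eq_C12 A B u v :
    arrow Gamma A B u -> arrow Gamma A B v -> eqC12 u v ->
    arrow_eq Gamma A B u v
| arrow_eq_C3 A B u v :
    arrow Gamma A B u -> arrow Gamma A B v -> eqC3 u v ->
    arrow_eq Gamma A B u v.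

(* Positions are counted from 0, so A[p,q]B exchanges |A| and |A| + 1.  The
   function is defined on all of nat; only its values on the positions
   i < |A| of the source matter, see [same_graph] and [graph_bij]. *)
Fixpoint graph (T : Type) (u : term T) (i : nat) : nat :=
  match u with
  | Basic (Id _) => i
  | Basic (Swap A _ _ _) =>
      if i == size A then (size A).+1
      else if i == (size A).+1 then size A else i
  | Comp v u => graph v (graph u i)
  end.

(* For u and v with source A. *)
Definition same_graph (T : Type) (A : seq T) (u v : term T) : Prop :=
  forall i, i < size A -> graph u i = graph v i.

(* The graph of u : A -> B is a bijection from the positions of A to those of
   B, and it sends each occurrence of an atom to an occurrence of that atom. *)
Lemma graph_bij (T : Type) (Gamma : basic T -> Prop) A B (u : term T) :
  arrow Gamma A B u ->
  [/\ forall i, i < size A -> graph u i < size B,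
      forall i j, i < size A -> j < size A -> graph u i = graph u j -> i = j,
      forall j, j < size B -> exists2 i, i < size A & graph u i = j &
      forall x0 i, i < size A -> nth x0 B (graph u i) = nth x0 A i].
Proof.
elim=> [[D|D p q E] _|{}A {}B C {}u v _ [u1 u2 u3 u4] _ [v1 v2 v3 v4]] /=.
- by split=> // j ltj; exists j.
- rewrite !size_cat /=; split.
  + by move=> i lti; do 2?case: ifP => ?; lia.
  + by move=> i j _ _; do 4?case: ifP => ?; lia.
  + move=> j ltj; case: (j =P size D) => [->|nj].
      by exists (size D).+1; [lia | case: ifP => ?; [lia | rewrite eqxx]].
    case: (j =P (size D).+1) => [->|mj]; first by exists (size D); [lia | rewrite eqxx].
    by exists j => //; do 2!(case: ifP => ?; first lia).
  + move=> x0 i _; rewrite !nth_cat.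
    case: eqP => [->|ni]; first by rewrite ltnNge leqnSn subSnn ltnn subnn.
    case: eqP => [->|mi]; first by rewrite ltnn subnn ltnNge leqnSn subSnn.
    case: ltnP => // led.
    by have [k ->] : exists k, i - size D = k.+2 by exists (i - size D - 2); lia.
- split.
  + by move=> i /u1 /v1.
  + by move=> i j Hi Hj /v2 h; apply: u2 => //; apply: h; apply: u1.
  + by move=> j /v3 [i /u3 [k ltk <-] <-]; exists k.
  + by move=> x0 i lti; rewrite v4 ?u4 // u1.
Qed.

(* Main.v *)
Require Import Defs.
From mathcomp Require Import all_boot.
From mathcomp Require Import zify.

Set Implicit Arguments.
Unset Strict Implicit.
Unset Printing Implicit Defensive.

(** The graph of an arrow term is the product of the adjacent transpositions
    that its swaps perform, so the theorem is the solution of the word problem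
    of the symmetric group, under the constraint that only the swaps of Gamma
    may appear.  What makes this possible is that words in the adjacent
    transpositions can be compared without ever lengthening them, as in Tits's
    solution for Coxeter groups: every word reaches a normal form by commuting
    distant letters, by braid moves and by deleting a repeated letter
    ([red_normal]), and two normal forms with the same action are equal
    ([normal_inj]).

    Each of these moves can be performed on arrow terms.  Commutations and
    braid moves are (C1) and (C2), and the closure condition on Gamma says
    that the rewritten term is still built from Gamma.  A deletion is (C3), and
    it introduces no swap; the reverse move, which would need a swap and its
    inverse in Gamma, does not occur.  Hence every arrow term is equal to one
    whose sequence of swap positions is a normal form ([lift_normal]).  If two
    terms of the same type have the same graph, their normal forms coincide,
    and the source together with the swap positions determines an arrow term up
    to identities and bracketing ([letters_unique]).  The converse holds because
    the graph respects each defining equation ([arrow_eq_graph]). *)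

Local Open Scope arrow_scope.

(** * Words in the adjacent transpositions *)

Definition transp (i x : nat) : nat :=
  if x == i then i.+1 else if x == i.+1 then i else x.

Definition act (w : seq nat) (x : nat) : nat :=
  foldl (fun y i => transp i y) x w.

(** Letters are performed from left to right.  No move lengthens a
    word, and the braid move is included only in the direction that leads to
    the normal form. *)
Inductive red : seq nat -> seq nat -> Prop :=
| red_refl w : red w w
| red_trans v w x : red v w -> red w x -> red v x
| red_cons i v w : red v w -> red (i :: v) (i :: w)
| red_far i j w : (i.+1 < j) || (j.+1 < i) -> red [:: i, j & w] [:: j, i & w]
| red_braid i w : red [:: i.+1, i, i.+1 & w] [:: i, i.+1, i & w]
| red_cancel i w : red [:: i, i & w] w.

(* Conditions whose left-hand side is itself a conditional are left for a later
   round, when that side has become a position. *)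
Ltac split_transp :=
  repeat match goal with |- context [?a == ?b] =>
    lazymatch a with
    | context [if _ then _ else _] => fail
    | _ => case: (a =P b) => ?
    end
  end; lia.

Lemma act_cat v w x : act (v ++ w) x = act w (act v x).
Proof. exact: foldl_cat. Qed.

Lemma transpK i : involutive (transp i).
Proof. by move=> x; rewrite /transp; split_transp. Qed.

Lemma act_inj w : injective (act w).
Proof.
by elim: w => [|i w IHw] x y //= /IHw /(can_inj (transpK i)).
Qed.

Lemma act_fix n w x : all (fun i => i < n) w -> n < x -> act w x = x.
Proof.
move=> + ltnx; elim: w => //= i w IHw /andP[ltin /IHw].
have -> // : transp i x = x by rewrite /transp; do 2!(case: eqP => ?; first lia).
Qed.

Lemma red_catl u v w : red v w -> red (u ++ v) (u ++ w).
Proof. by move=> rvw; elim: u => //= i u; apply: red_cons. Qed.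

Lemma red_catr u v w : red v w -> red (v ++ u) (w ++ u).
Proof.
elim=> [{}w|{}v {}w x _ IH1 _ IH2|i {}v {}w _ IH|i j {}w ij|i {}w|i {}w] /=.
- exact: red_refl.
- exact: red_trans IH2.
- exact: red_cons.
- exact: red_far.
- exact: red_braid.
- exact: red_cancel.
Qed.

Lemma red_far_word i w :
  all (fun j => (j.+1 < i) || (i.+1 < j)) w -> red (w ++ [:: i]) (i :: w).
Proof.
elim: w => [_|j w IHw /= /andP[ji /IHw rw]]; first exact: red_refl.
by apply: red_trans (red_cons j rw) _; apply: red_far.
Qed.

(** * Normal forms *)

(** The descending run k + m - 1, ..., k. *)
Definition desc (k m : nat) : seq nat := rev (iota k m).

(** A normal form in the letters below n.+1 is a normal form in the letters
    below n, which fixes the position n.+1, followed by a descending run that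
    carries n.+1 to k; the run is empty when k = n.+1. *)
Inductive normal : nat -> seq nat -> Prop :=
| normal0 : normal 0 [::]
| normalS n w k m : normal n w -> k + m = n.+1 -> normal n.+1 (w ++ desc k m).

Lemma desc_cat k m1 m2 : desc k (m1 + m2) = desc (k + m1) m2 ++ desc k m1.
Proof. by rewrite /desc iotaD rev_cat. Qed.

Lemma act_desc k m : act (desc k m) (k + m) = k.
Proof.
elim: m => [|m IHm]; first by rewrite addn0.
rewrite -addn1 desc_cat act_cat addn1 /= /transp addnS eqxx.
by rewrite ifF ?IHm //; lia.
Qed.

(** A letter i in the interior of a descending run passes through it from the
    right to the left and becomes i - 1: it commutes with the lower part
    of the run, a braid move on i, i - 1, i turns it into i - 1, and this commutes
    with the upper part. *)
Lemma red_desc k m i : k < i < k + m ->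
  red (desc k m ++ [:: i]) (i.-1 :: desc k m).
Proof.
case: i => // i /andP[ki im].
have -> : m = (i - k) + (2 + (k + m - i.+2)) by lia.
rewrite !desc_cat -!catA subnKC //.
have -> : desc i 2 = [:: i.+1; i] by [].
set lo := desc k _; set hi := desc (i + 2) _.
have rlo : red (lo ++ [:: i.+1]) (i.+1 :: lo).
  by apply: red_far_word; apply/allP => j; rewrite mem_rev mem_iota; lia.
have rhi : red (hi ++ [:: i]) (i :: hi).
  by apply: red_far_word; apply/allP => j; rewrite mem_rev mem_iota; lia.
apply: red_trans (red_catl hi (red_catl [:: i.+1; i] rlo)) _ => /=.
apply: red_trans (red_catl hi (red_braid i lo)) _.
by have := red_catr [:: i.+1, i & lo] rhi; rewrite -catA.
Qed.

(** Let k be the last letter of the final run, or the number of letters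
    available if the run is empty.  A new letter i extends the run
    if i = k - 1, cancels k if i = k, and otherwise passes to the left of the run,
    unchanged if i < k - 1 and as i - 1 if i > k, to be absorbed by the shorter
    normal form. *)
Lemma normal_absorb n w i : normal n w -> i < n ->
  exists2 w', normal n w' & red (w ++ [:: i]) w'.
Proof.
move=> nw; elim: nw i => // {}n {}w k m nw IHw km i ltin.
have absorb_left j : j < n -> red (desc k m ++ [:: i]) (j :: desc k m) ->
    exists2 w', normal n.+1 w' & red ((w ++ desc k m) ++ [:: i]) w'.
  move=> /IHw[w' nw' rw'] rj; exists (w' ++ desc k m); first exact: normalS.
  rewrite -catA; apply: red_trans (red_catl w rj) _.
  by have := red_catr (desc k m) rw'; rewrite -catA.
case: (ltngtP i k) => [ltik|ltki|eqik].
- have [eqk|ltk] := eqVneq i.+1 k.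
    exists (w ++ desc i m.+1); first by apply: normalS => //; lia.
    by rewrite -catA -(add1n m) desc_cat addn1 eqk; apply: red_refl.
  apply: (absorb_left i); first lia.
  by apply: red_far_word; apply/allP => j; rewrite mem_rev mem_iota; lia.
- by apply: (absorb_left i.-1); [lia | apply: red_desc; lia].
- exists (w ++ desc k.+1 m.-1); first by apply: normalS => //; lia.
  have -> : m = 1 + m.-1 by lia.
  rewrite desc_cat addn1 /= -!catA eqik.
  by apply: red_catl; rewrite -[X in red _ X]cats0; apply: red_catl; apply: red_cancel.
Qed.

Lemma red_normal n w : all (fun i => i < n) w -> exists2 w', normal n w' & red w w'.
Proof.
elim/last_ind: w => [_|w i IHw].
  exists [::]; last exact: red_refl.
  elim: n => [|n IHn]; first exact: normal0.
  by have := normalS IHn (addn0 n.+1).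
rewrite all_rcons -cats1 => /andP[ltin /IHw[w' nw' rw']].
have [w'' nw'' rw''] := normal_absorb nw' ltin.
by exists w'' => //; apply: red_trans (red_catr _ rw') rw''.
Qed.

Lemma normal_bound n w : normal n w -> all (fun i => i < n) w.
Proof.
elim=> // {}n {}w k m _ IHw km; rewrite all_cat; apply/andP; split.
  by apply: sub_all IHw => i; lia.
by apply/allP => j; rewrite mem_rev mem_iota; lia.
Qed.

(** The last run is determined by the image of the greatest position, and it
    can then be cancelled because it acts injectively. *)
Lemma normal_inj n v w : normal n v -> normal n w -> act v =1 act w -> v = w.
Proof.
move=> nv; elim: nv w => [|{}n {}v k m nv IHv km] w nw.
  by inversion nw.
inversion nw as [|n' w' k' m' nw' km' eqn eqw] => eqa; subst.
have top u j r : normal n u -> j + r = n.+1 -> act (u ++ desc j r) n.+1 = j.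
  move=> nu jr; rewrite act_cat (act_fix (normal_bound nu)) //.
  by rewrite -jr act_desc.
have eqk : k = k' by rewrite -(top v k m) // eqa top.
have eqm : m = m' by lia.
rewrite -{}eqk -{}eqm in eqa *; congr (_ ++ _); apply: IHv => // x.
by apply: (@act_inj (desc k m)); rewrite -!act_cat eqa.
Qed.

(** * Arrow terms as words in the adjacent transpositions *)

(** Listed in the order in which the swaps are performed. *)
Fixpoint letters (T : Type) (u : term T) : seq nat :=
  match u with
  | Basic (Id _) => [::]
  | Basic (Swap A _ _ _) => [:: size A]
  | Comp v u => letters u ++ letters v
  end.

Lemma graph_letters (T : Type) (u : term T) : graph u =1 act (letters u).
Proof.
elim: u => [[A|A p q B]|v IHv u IHu] x //=.
by rewrite act_cat IHu IHv.
Qed.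

Lemma letters_bound (T : Type) (Gamma : basic T -> Prop) A B (u : term T) :
  arrow Gamma A B u ->
  size A = size B /\ all (fun i => i < (size A).-1) (letters u).
Proof.
elim=> [[D|D p q E] _|{}A {}B C {}u v _ [sAB bu] _ [sBC bv]] //=.
  by rewrite !size_cat /= andbT; split=> //; lia.
by rewrite all_cat bu sAB bv.
Qed.

(** The two sides of each equation have the same graph on all of nat, not only on
    the positions of the source, so composition needs no typing argument. *)
Lemma arrow_eq_graph (T : Type) (Gamma : basic T -> Prop) A B (u v : term T) :
  arrow_eq Gamma A B u v -> graph u =1 graph v.
Proof.
elim=> [//|{}A {}B {}u {}v _ IH x|{}A {}B {}u {}v w _ IH1 _ IH2 x
  |{}A {}B C {}u u' {}v v' _ IH1 _ IH2 x|//|//|//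
  |{}A {}B {}u {}v _ _ [D r s U p q E|D p r s E] x
  |{}A {}B {}u {}v _ _ [D p r E] x].
- by rewrite IH.
- by rewrite IH1.
- by rewrite /= IH1 IH2.
- rewrite /= !size_cat /=.
  by split_transp.
- rewrite /= !size_cat /=.
  by split_transp.
- exact: transpK.
Qed.

Lemma cat_eq_split (T : Type) (A A' B B' : seq T) :
  A ++ B = A' ++ B' -> size A <= size A' ->
  exists2 U, A' = A ++ U & B = U ++ B'.
Proof.
elim: A A' => [|a A IHA] [|a' A'] //=; first by move=> ->; exists [::].
  by move=> -> _; exists (a' :: A').
by case=> -> /IHA/[apply] -[U -> ->]; exists U.
Qed.

Lemma cat_eq_size (T : Type) (A A' B B' : seq T) :
  A ++ B = A' ++ B' -> size A = size A' -> A = A' /\ B = B'.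
Proof.
elim: A A' => [|a A IHA] [|a' A'] //= [-> /IHA eqAB] [/eqAB] [-> ->] //.
Qed.

(** * Performing the moves on arrow terms *)

Section Arrows.
Variables (T : Type) (obj : seq T -> Prop) (Gamma : basic T -> Prop).
Hypothesis hGamma : basic_arrow_set obj Gamma.

Local Notation arr := (arrow Gamma).
Local Notation arr_eq := (arrow_eq Gamma).

Lemma arrow_basic_at A B b : Gamma b -> src b = A -> tgt b = B -> arr A B b.
Proof. by move=> gb <- <-; apply: arrow_basic. Qed.

Lemma Id_arrow A : Gamma (Id A) -> arr A A (Id A).
Proof. by move=> gA; apply: arrow_basic gA. Qed.

Lemma Gamma_tgt A p q B : Gamma (Swap A p q B) -> Gamma (Id (A ++ [:: q; p] ++ B)).
Proof. by move=> /(Gamma_swap hGamma)[_ /(Gamma_id hGamma)]. Qed.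

Lemma Gamma_src A p q B : Gamma (Swap A p q B) -> Gamma (Id (A ++ [:: p; q] ++ B)).
Proof. by move=> /(Gamma_swap hGamma)[/(Gamma_id hGamma)]. Qed.

Lemma arrow_id A B u : arr A B u -> Gamma (Id A) /\ Gamma (Id B).
Proof.
elim=> [[D|D p q E] gb|{}A {}B C {}u v _ [gA _] _ [_ gC]] //=.
by split; [apply: Gamma_src gb | apply: Gamma_tgt gb].
Qed.

Lemma arr_eq_comp_l A B C u v v' :
  arr A B u -> arr_eq B C v v' -> arr_eq A C (v ∘ u) (v' ∘ u).
Proof. by move=> au; apply: arrow_eq_comp; apply: arrow_eq_refl. Qed.

Lemma arr_eq_comp_r A B C u u' v :
  arr B C v -> arr_eq A B u u' -> arr_eq A C (v ∘ u) (v ∘ u').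
Proof. by move=> av equ; apply: arrow_eq_comp equ (arrow_eq_refl av). Qed.

Lemma letters_nil A B u : arr A B u -> letters u = [::] ->
  A = B /\ arr_eq A B u (Id A).
Proof.
elim=> [[D|D p q E] gb|{}A {}B C {}u v _ IHu av IHv] //=.
  by split=> //; apply: arrow_eq_refl; apply: arrow_basic gb.
case: (letters u) IHu => //= /(_ erefl)[eqAB equ] /IHv[eqBC eqv].
subst B C; split=> //.
apply: arrow_eq_trans (arrow_eq_comp equ eqv) _.
by apply: arrow_eq_idr; apply: Id_arrow; case: (arrow_id av).
Qed.

(** Up to identities and associativity, the first swap of an arrow term can be
    split off. *)
Lemma letters_cons A B u i l : arr A B u -> letters u = i :: l ->
  exists A1 p q B1 w,
    [/\ A = A1 ++ [:: p; q] ++ B1, size A1 = i & Gamma (Swap A1 p q B1)] /\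
    [/\ arr (A1 ++ [:: q; p] ++ B1) B w, letters w = l &
        arr_eq A B u (w ∘ Swap A1 p q B1)].
Proof.
move=> au; elim: au l => [[D|D p q E] gb|{}A {}B C {}u v au IHu av IHv] l //=.
  case=> <- <-; exists D, p, q, E, (Id (D ++ [:: q; p] ++ E)); split=> //.
  split=> //; first exact: Id_arrow (Gamma_tgt gb).
  by apply: arrow_eq_sym; apply: arrow_eq_idl; apply: arrow_basic gb.
case lu: (letters u) IHu => [|j m] /= IHu.
  move=> lv; have [eqAB equ] := letters_nil au lu; subst B.
  have [A1 [p [q [B1 [w [hA [aw lw eqv]]]]]]] := IHv _ lv.
  exists A1, p, q, B1, w; split=> //; split=> //.
  apply: arrow_eq_trans eqv; apply: arrow_eq_trans (arrow_eq_idr av).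
  exact: arr_eq_comp_r av equ.
case=> eqj <-; rewrite eqj in IHu.
have [A1 [p [q [B1 [w [[eqA sA gA] [aw lw equ]]]]]]] := IHu _ erefl.
exists A1, p, q, B1, (v ∘ w); split=> //; split=> /=; first exact: arrow_comp av.
  by rewrite lw.
apply: arrow_eq_trans (arr_eq_comp_r av equ) _.
apply: arrow_eq_sym; apply: arrow_eq_assoc aw av.
by apply: arrow_basic_at gA _ _.
Qed.

(** The source and the position of a swap determine its atoms and its target, so
    the swaps of two terms agree one after the other. *)
Lemma letters_unique A B C u v : arr A B u -> arr A C v ->
  letters u = letters v -> arr_eq A B u v.
Proof.
suff: forall l A B C u v, arr A B u -> arr A C v ->
    letters u = l -> letters v = l -> B = C /\ arr_eq A B u v.
  by move=> U au av eqL; have [] := U _ _ _ _ _ _ au av eqL erefl.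
elim=> [|i l IHl] {}A {}B {}C {}u {}v au av lu lv.
  have [eqAB equ] := letters_nil au lu; have [eqAC eqv] := letters_nil av lv.
  by subst B C; split=> //; apply: arrow_eq_trans equ (arrow_eq_sym eqv).
have [A1 [p [q [B1 [u' [[eqA sA gA] [au' lu' equ]]]]]]] := letters_cons au lu.
have [A2 [x [y [B2 [v' [[eqA' sA' gA'] [av' lv' eqv]]]]]]] := letters_cons av lv.
have [eqA12 [eqx eqy eqB12]] : A2 = A1 /\ [:: x, y & B2] = [:: p, q & B1].
  by apply: cat_eq_size; rewrite ?sA // -eqA'.
subst A2 x y B2; have [eqBC equv] := IHl _ _ _ _ _ au' av' lu' lv'.
subst C; split=> //; apply: arrow_eq_trans equ _.
apply: arrow_eq_trans (arrow_eq_sym eqv).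
by apply: arr_eq_comp_l equv; apply: arrow_basic_at gA _ _.
Qed.

Definition lifts A B u l :=
  exists2 v, arr A B v /\ letters v = l & arr_eq A B u v.

(** This is where the closure condition on Gamma is used: it provides the basic
    terms of the other side y of the equation. *)
Lemma lift_C12 A B C u w x y : eqC12 x y \/ eqC12 y x ->
  arr A B x -> (basics_in Gamma y -> arr A B y) -> basics_in Gamma x ->
  arr B C w -> arr_eq A C u (w ∘ x) -> lifts A C u (letters y ++ letters w).
Proof.
move=> xy ax ay gx aw equ.
have gy : basics_in Gamma y by case: xy => /(Gamma_C12 hGamma)[? ?]; auto.
have {gy} ay := ay gy.
exists (w ∘ y); first by split=> //; apply: arrow_comp ay aw.
apply: arrow_eq_trans equ (arr_eq_comp_r aw _).
by case: xy => xy; [|apply: arrow_eq_sym]; apply: arrow_eq_C12.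
Qed.

Lemma letters_cons2 A B u i j l : arr A B u -> letters u = [:: i, j & l] ->
  exists A1 p q B1 A2 x y B2 w,
    [/\ A = A1 ++ [:: p; q] ++ B1, size A1 = i & Gamma (Swap A1 p q B1)] /\
    [/\ A1 ++ [:: q; p] ++ B1 = A2 ++ [:: x; y] ++ B2, size A2 = j
       & Gamma (Swap A2 x y B2)] /\
    [/\ arr (A2 ++ [:: y; x] ++ B2) B w, letters w = l &
        arr_eq A B u (w ∘ (Swap A2 x y B2 ∘ Swap A1 p q B1))].
Proof.
move=> au /(letters_cons au)[A1 [p [q [B1 [w1 [[eqA sA gA] [aw1 lw1 equ]]]]]]].
have [A2 [x [y [B2 [w [[eqA' sA' gA'] [aw lw eqw1]]]]]]] := letters_cons aw1 lw1.
have a1 : arr A (A1 ++ [:: q; p] ++ B1) (Swap A1 p q B1) by apply: arrow_basic_at.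
have a2 : arr (A1 ++ [:: q; p] ++ B1) (A2 ++ [:: y; x] ++ B2) (Swap A2 x y B2).
  by apply: arrow_basic_at.
exists A1, p, q, B1, A2, x, y, B2, w; do !split=> //.
apply: arrow_eq_trans equ _; apply: arrow_eq_trans (arr_eq_comp_l a1 eqw1) _.
exact: arrow_eq_assoc a1 a2 aw.
Qed.

(** The two inequalities between the positions are the two directions of (C1). *)
Lemma lift_far A B u i j l : (i.+1 < j) || (j.+1 < i) ->
  arr A B u -> letters u = [:: i, j & l] -> lifts A B u [:: j, i & l].
Proof.
move=> ij au /(letters_cons2 au)[A1 [p [q [B1 [A2 [x [y [B2 [w]]]]]]]]].
case=> -[eqA sA1 g1] [[eqA' sA2 g2] [aw lw equ]]; rewrite -lw.
case/orP: ij => ij.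
- have [U eA2 eB1] : exists2 U, A2 = (A1 ++ [:: q; p]) ++ U & B1 = U ++ [:: x; y] ++ B2.
    by apply: cat_eq_split; rewrite -?catA // size_cat /=; lia.
  subst A2 B1; rewrite -!catA in eqA' g2 aw equ sA2 *.
  have -> : [:: j, i & letters w] =
      letters (Swap A1 p q (U ++ [:: y; x] ++ B2)
         ∘ Swap (A1 ++ [:: p; q] ++ U) x y B2) ++ letters w.
    by rewrite /= sA1 -sA2 !size_cat.
  apply: lift_C12 equ => //; first by left; apply: EqC1.
  + by apply: arrow_comp (arrow_basic_at g1 _ _) (arrow_basic_at g2 _ _); rewrite //= -?catA.
  + case=> g1' g2'; rewrite eqA.
    by apply: arrow_comp (arrow_basic_at g2' _ _) (arrow_basic_at g1' _ _); rewrite //= -?catA.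
  + by rewrite /= -catA.
- have [U eA1 eB2] : exists2 U, A1 = (A2 ++ [:: x; y]) ++ U & B2 = U ++ [:: q; p] ++ B1.
    by apply: cat_eq_split; rewrite -?catA // size_cat /=; lia.
  subst A1 B2; rewrite -!catA in eqA eqA' g1 aw equ sA1 *.
  have -> : [:: j, i & letters w] =
      letters (Swap (A2 ++ [:: y; x] ++ U) p q B1
         ∘ Swap A2 x y (U ++ [:: p; q] ++ B1)) ++ letters w.
    by rewrite /= sA2 -sA1 !size_cat.
  apply: lift_C12 equ => //; first by right; apply: EqC1.
  + by apply: arrow_comp (arrow_basic_at g1 _ _) (arrow_basic_at g2 _ _); rewrite //= -?catA.
  + case=> g1' g2'; rewrite eqA.
    by apply: arrow_comp (arrow_basic_at g2' _ _) (arrow_basic_at g1' _ _); rewrite //= -?catA.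
  + exact: aw.
Qed.

(** A second swap at the same position undoes the first, so the two form an
    instance of (C3). *)
Lemma lift_cancel A B u i l :
  arr A B u -> letters u = [:: i, i & l] -> lifts A B u l.
Proof.
move=> au /(letters_cons2 au)[A1 [p [q [B1 [A2 [x [y [B2 [w]]]]]]]]].
case=> -[eqA sA1 g1] [[eqA' sA2 g2] [aw lw equ]].
have [eA [ex ey eB]] : A2 = A1 /\ [:: x, y & B2] = [:: q, p & B1].
  by apply: cat_eq_size; rewrite ?sA1 // -eqA'.
subst A2 x y B2; rewrite -eqA in aw.
exists w => //; apply: arrow_eq_trans equ _.
apply: arrow_eq_trans (arrow_eq_idr aw); apply: arr_eq_comp_r aw _.
rewrite eqA; apply: arrow_eq_C3; last exact: EqC3.
- by apply: arrow_comp (arrow_basic_at g1 _ _) (arrow_basic_at g2 _ _).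
- exact: Id_arrow (Gamma_src g1).
Qed.

(** The positions i + 1, i, i + 1 force the first swap to exchange p and q just
    after an atom x, the second to exchange x and q, and the third to exchange x
    and p, as on the left-hand side of (C2). *)
Lemma lift_braid A B u i l : arr A B u -> letters u = [:: i.+1, i, i.+1 & l] ->
  lifts A B u [:: i, i.+1, i & l].
Proof.
move=> au /(letters_cons2 au)[A1 [p [q [B1 [A2 [x [y [B2 [w1]]]]]]]]].
case=> -[eqA sA1 g1] [[eqA' sA2 g2] [aw1 lw1 equ]].
have [A3 [a [b [B3 [w [[eqA'' sA3 g3] [aw lw eqw1]]]]]]] := letters_cons aw1 lw1.
have [[|s [|s1 U]] eA1] : exists2 U, A1 = A2 ++ U & [:: x, y & B2] = U ++ [:: q, p & B1].
- by apply: cat_eq_split; [rewrite -eqA' | lia].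
- by move: sA1; rewrite eA1 cats0; lia.
- case=> ? ? ?; subst s y B2.
  have [eA3 [ea eb eB3]] : A3 = A2 ++ [:: q] /\ [:: a, b & B3] = [:: x, p & B1].
    apply: cat_eq_size; last by rewrite sA3 size_cat /= addn1 sA2.
    by rewrite -eqA'' -catA.
  subst A1 A3 a b B3; rewrite -!catA /= in eqA eqA' eqA'' aw1 aw *.
  have -> : [:: i, i.+1, i & l] =
      letters (Swap A2 p q ([:: x] ++ B1) ∘ Swap (A2 ++ [:: p]) x q B1
             ∘ Swap A2 x p ([:: q] ++ B1)) ++ letters w.
    by rewrite /= !size_cat /= sA2 lw addn1.
  have a1 : arr A (A2 ++ [:: x; q; p] ++ B1) (Swap (A2 ++ [:: x]) p q B1).
    by apply: arrow_basic_at g1 _ _; rewrite ?eqA /= -?catA.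
  have a2 : arr (A2 ++ [:: x; q; p] ++ B1) (A2 ++ [:: q; x; p] ++ B1)
      (Swap A2 x q ([:: p] ++ B1)) by apply: arrow_basic_at g2 _ _.
  have a3 : arr (A2 ++ [:: q; x; p] ++ B1) (A2 ++ [:: q; p; x] ++ B1)
      (Swap (A2 ++ [:: q]) x p B1) by apply: arrow_basic_at g3 _ _; rewrite /= -catA.
  have a21 := arrow_comp a1 a2.
  apply: (@lift_C12 A _ _ _ _
      (Swap (A2 ++ [:: q]) x p B1 ∘ Swap A2 x q ([:: p] ++ B1)
         ∘ Swap (A2 ++ [:: x]) p q B1) _ _ (arrow_comp a1 (arrow_comp a2 a3)) _ _ aw).
  + by left; apply: EqC2.
  + case=> -[h3 h2] h1; rewrite eqA.
    apply: arrow_comp (arrow_basic_at h1 _ _) _ => //.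
    by apply: arrow_comp (arrow_basic_at h2 _ _) (arrow_basic_at h3 _ _); rewrite /= -?catA.
  + by [].
  + apply: arrow_eq_trans equ _.
    apply: arrow_eq_trans (arr_eq_comp_l a21 eqw1) _.
    apply: arrow_eq_trans (arrow_eq_assoc a21 a3 aw) _.
    by apply: arr_eq_comp_r aw _; apply: arrow_eq_sym; apply: arrow_eq_assoc a1 a2 a3.
- by move=> _; move: sA1; rewrite eA1 size_cat /=; lia.
Qed.

Lemma lift_red v w A B u : red v w -> arr A B u -> letters u = v -> lifts A B u w.
Proof.
move=> vw; elim: vw A B u => {v w} [w|v w x _ IH1 _ IH2|i v w _ IH|i j w ij|i w|i w] A B u au lu.
- by exists u => //; apply: arrow_eq_refl.
- have [u1 [au1 lu1] equ] := IH1 _ _ _ au lu.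
  have [u2 [au2 lu2] eqv] := IH2 _ _ _ au1 lu1.
  by exists u2 => //; apply: arrow_eq_trans equ eqv.
- have [A1 [p [q [B1 [u' [[eqA sA gA] [au' lu' equ]]]]]]] := letters_cons au lu.
  have [v' [av' lv'] eqv] := IH _ _ _ au' lu'.
  have a1 : arr A (A1 ++ [:: q; p] ++ B1) (Swap A1 p q B1) by apply: arrow_basic_at.
  exists (v' ∘ Swap A1 p q B1); first by split; [apply: arrow_comp a1 av' | rewrite /= sA lv'].
  exact: arrow_eq_trans equ (arr_eq_comp_l a1 eqv).
- exact: lift_far lu.
- exact: lift_braid lu.
- exact: lift_cancel lu.
Qed.

Lemma lift_normal A B u : arr A B u ->
  exists2 v, arr A B v /\ normal (size A).-1 (letters v) & arr_eq A B u v.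
Proof.
move=> au; have [_ /red_normal[w nw rw]] := letters_bound au.
by have [v [av lv] equ] := lift_red rw au erefl; exists v; rewrite ?lv.
Qed.

End Arrows.

(** Equality of graphs on the positions of the source therefore extends to all
    of nat, where normal forms are compared. *)
Lemma graph_outside (T : Type) (Gamma : basic T -> Prop) A B (u : term T) i :
  arrow Gamma A B u -> size A <= i -> graph u i = i.
Proof.
move=> /letters_bound[_ bu] ltAi; rewrite graph_letters.
case: A bu ltAi => [|a A] /= bu ltAi; last exact: act_fix bu ltAi.
by case: (letters u) bu.
Qed.

Theorem mainTheorem4 (T : Type) (obj : seq T -> Prop) (Gamma : basic T -> Prop)
    (hGamma : basic_arrow_set obj Gamma)
    (A B : seq T) (u v : term T)
    (hu : arrow Gamma A B u) (hv : arrow Gamma A B v) :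
  arrow_eq Gamma A B u v <-> same_graph A u v.
Proof.
split=> [equv i _|guv]; first exact: arrow_eq_graph equv i.
have eqg : graph u =1 graph v.
  move=> i; case: (ltnP i (size A)) => [/guv //|leAi].
  by rewrite (graph_outside hu leAi) (graph_outside hv leAi).
have [u' [au' nu'] equ] := lift_normal hGamma hu.
have [v' [av' nv'] eqv] := lift_normal hGamma hv.
have eqL : letters u' = letters v'.
  apply: normal_inj nu' nv' _ => i; rewrite -!graph_letters.
  by rewrite -(arrow_eq_graph equ) -(arrow_eq_graph eqv) eqg.
apply: arrow_eq_trans equ (arrow_eq_trans _ (arrow_eq_sym eqv)).
exact: (letters_unique hGamma au' av' eqL).
Qed.
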